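(* Let $c,L,\xi>0$, $N\in\mathbb{N}$ and $h=\frac{L}{N+1}$. There exists a constant $\delta$ with $0<\delta<\frac{2\xi c^2}{L(c^2+\xi^2)}$ such that for all initial conditions $\vec v^0,\vec v^1\in\mathbb{R}^{N+2}$, the energy $E_h^{FEM}(t)$ of the corresponding solution of the finite element system satisfies, for all $t>0$, $$E_h^{FEM}(t)\le \frac{c+\delta L}{c-\delta L}\,e^{-\delta\left(1-\frac{L\delta}{c}\right)\left(1-\frac{\kappa^{FEM}}{12c^2}\right)t}\,E_h^{FEM}(0).$$
   Context: Finite element system (semi-discretization by linear splines of the boundary-damped wave equation on $(0,L)$): for real functions $v_0(t),\dots,v_{N+1}(t)$, $t\ge0$, $$\frac{\ddot v_{j+1}+4\ddot v_j+\ddot v_{j-1}}{6}-c^2\frac{v_{j+1}-2v_j+v_{j-1}}{h^2}=0\ (1\le j\le N),$$ $$v_0=0,\qquad \frac{2\ddot v_{N+1}+\ddot v_N}{6}+c^2\frac{v_{N+1}-v_N}{h^2}=-\frac{\xi}{h}\dot v_{N+1},$$ with initial data $v_j(0)=v_j^0$, $\dot v_j(0)=v_j^1$, $j=0,\dots,N+1$, where $\vec v^0=(v^0_0,\dots,v^0_{N+1})$, $\vec v^1=(v^1_0,\dots,v^1_{N+1})$ are compatible with $v_0\equiv0$ (i.e. $v^0_0=v^1_0=0$). Energy: $$E_h^{FEM}(t)=\frac{h}{12}\left[|\dot v_{N+1}|^2+\sum_{j=0}^{N}\left(2|\dot v_j|^2+|\dot v_j+\dot v_{j+1}|^2+6c^2\left|\frac{v_{j+1}-v_j}{h}\right|^2\right)\right].$$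 $\kappa^{FEM}=\max h^2|\lambda|^2$, the maximum being over the eigenvalues $\lambda=\lambda_j^{FEM}(\xi,h)$ of the real $(2N+2)\times(2N+2)$ matrix $\mathcal{A}_h^{FEM}(\xi)$ that writes the system in first-order form $\frac{d}{dt}(\vec u_1,\vec u_2)=\mathcal{A}_h^{FEM}(\xi)(\vec u_1,\vec u_2)=(\vec u_2,-M^{-1}A_h\vec u_1+M^{-1}B_h\vec u_2)$ with $\vec u_1=(v_1,\dots,v_{N+1})^{\rm T}$, $\vec u_2=(\dot v_1,\dots,\dot v_{N+1})^{\rm T}$. Here, all matrices being $(N+1)\times(N+1)$: $A_h$ is $\frac{c^2}{h^2}$ times the tridiagonal matrix with off-diagonal entries $-1$, diagonal entries $2$ in rows $1,\dots,N$ and $1$ in row $N+1$; $M$ is the tridiagonal matrix with off-diagonal entries $\frac16$, diagonal entries $\frac23$ in rows $1,\dots,N$ and $\frac13$ in row $N+1$; the only nonzero entry of $B_h$ is $(B_h)_{N+1,N+1}=-\xi/h$. *)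

(* Defs.v *)
From HB Require Import structures.
From mathcomp Require Import all_boot all_order all_algebra.
From mathcomp Require Import all_classical all_reals all_analysis.
From mathcomp Require Import complex.
Set Implicit Arguments.
Unset Strict Implicit.
Unset Printing Implicit Defensive.
Import Order.TTheory GRing.Theory Num.Theory numFieldNormedType.Exports.
Local Open Scope classical_set_scope.
Local Open Scope ring_scope.

(* Time derivative of a function on the half-line [0, +oo[: the difference
   quotient is taken within [0, +oo[, so this is the right derivative at 0 and
   the usual derivative at t > 0.  Values of f at negative times are never
   used. *)
Definition tquot (R : realType) (f : R -> R) (t s : R) : R :=
  (f s - f t) / (s - t).

Definition tderivable (R : realType) (f : R -> R) (t : R) : Prop :=
  cvg (tquot f t s @[s --> within [set s | 0 <= s] t^']).

Definition tderive (R : realType) (f : R -> R) (t : R) : R :=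
  lim (tquot f t s @[s --> within [set s | 0 <= s] t^']).

Record fem_solution (R : realType) (c xi h : R) (N : nat)
    (v0 v1 : 'rV[R]_N.+2) (v : 'I_N.+2 -> R -> R) : Prop := FemSolution {
  fem_derivable : forall j t, 0 <= t -> tderivable (v j) t ;
  fem_derivable2 : forall j t, 0 <= t -> tderivable (tderive (v j)) t ;
  fem_interior : forall (j : nat) t, (1 <= j <= N)%N -> 0 <= t ->
    (tderive (tderive (v (inord j.+1))) t
       + 4 * tderive (tderive (v (inord j))) t
       + tderive (tderive (v (inord j.-1))) t) / 6
    - c ^+ 2 * ((v (inord j.+1) t - 2 * v (inord j) t + v (inord j.-1) t)
                / h ^+ 2) = 0 ;
  fem_left : forall t, 0 <= t -> v (inord 0) t = 0 ;
  fem_right : forall t, 0 <= t ->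
    (2 * tderive (tderive (v (inord N.+1))) t
       + tderive (tderive (v (inord N))) t) / 6
    + c ^+ 2 * ((v (inord N.+1) t - v (inord N) t) / h ^+ 2)
    = - (xi / h) * tderive (v (inord N.+1)) t ;
  fem_init0 : forall j, v j 0 = v0 0 j ;
  fem_init1 : forall j, tderive (v j) 0 = v1 0 j
}.

Definition fem_energy (R : realType) (c h : R) (N : nat)
    (v : 'I_N.+2 -> R -> R) (t : R) : R :=
  h / 12 *
  (`|tderive (v (inord N.+1)) t| ^+ 2
   + \sum_(0 <= j < N.+1)
       (2 * `|tderive (v (inord j)) t| ^+ 2
        + `|tderive (v (inord j)) t + tderive (v (inord j.+1)) t| ^+ 2
        + 6 * c ^+ 2 * `|(v (inord j.+1) t - v (inord j) t) / h| ^+ 2)).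

(* Tridiagonal matrix of order N+1 with off-diagonal entries a, diagonal
   entries d except the last one, which is e.  Rows and columns are numbered
   from 0, so the last index is N. *)
Definition tridiag_mx (R : realType) (N : nat) (a d e : R) : 'M[R]_N.+1 :=
  \matrix_(i, j)
    if i == j then (if i == ord_max then e else d)
    else if (i == j.+1 :> nat) || (j == i.+1 :> nat) then a else 0.

Definition fem_stiffness (R : realType) (c h : R) (N : nat) : 'M[R]_N.+1 :=
  c ^+ 2 / h ^+ 2 *: tridiag_mx N (- 1) 2 1.

(* Strictly diagonally dominant, so invmx below is the actual inverse. *)
Definition fem_mass (R : realType) (N : nat) : 'M[R]_N.+1 :=
  tridiag_mx N (1 / 6) (2 / 3) (1 / 3).

Definition fem_damping (R : realType) (xi h : R) (N : nat) : 'M[R]_N.+1 :=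
  - (xi / h) *: delta_mx ord_max ord_max.

Definition fem_matrix (R : realType) (c xi h : R) (N : nat) :
    'M[R]_(N.+1 + N.+1) :=
  block_mx 0 1%:M
    (- (invmx (fem_mass R N) *m fem_stiffness c h N))
    (invmx (fem_mass R N) *m fem_damping xi h N).

(* The norm of R[i] is R[i]-valued; its real part is the modulus as an element
   of R. *)
Definition fem_spectral_values (R : realType) (c xi h : R) (N : nat) : set R :=
  [set x | exists2 l : R[i],
     eigenvalue (map_mx (real_complex R) (fem_matrix c xi h N)) l
     & x = h ^+ 2 * (complex.Re `|l|) ^+ 2].

(* The spectrum over R[i] is finite and nonempty, so this supremum is a
   maximum (fem_kappa_max). *)
Definition fem_kappa (R : realType) (c xi h : R) (N : nat) : R :=
  sup (fem_spectral_values c xi h N).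

Lemma fem_kappa_max (R : realType) (c xi h : R) (N : nat) :
  fem_spectral_values c xi h N (fem_kappa c xi h N) /\
  ubound (fem_spectral_values c xi h N) (fem_kappa c xi h N).
Proof.
set A := map_mx (real_complex R) (fem_matrix c xi h N).
have [r rE] := closed_field_poly_normal (char_poly A).
rewrite (monicP (char_poly_monic _)) scale1r in rE.
pose f (l : R[i]) : R := h ^+ 2 * (complex.Re `|l|) ^+ 2.
have eigE l : eigenvalue A l = (l \in r).
  by rewrite eigenvalue_root_char rE root_prod_XsubC.
have SE : fem_spectral_values c xi h N = [set x | x \in map f r].
  apply/seteqP; split=> x /=.
    by move=> [l] /=; rewrite eigE => lr ->; apply: map_f.
  by move=> /mapP[l lr ->]; exists l; rewrite ?eigE.
have rn : r != [::].
  apply/eqP => r0; have := congr1 (size \o @polyseq _) rE.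
  by rewrite /= size_char_poly r0 big_nil size_poly1.
case: r rn eigE SE {rE} => // l0 r _ _ SE.
pose m := \big[Order.max/f l0]_(x <- map f (l0 :: r)) x.
have mub : ubound (fem_spectral_values c xi h N) m.
  by move=> x; rewrite SE /= => xr; exact: le_bigmax_seq.
have mS : fem_spectral_values c xi h N m.
  rewrite SE /= /m big_seq; elim/big_ind: _ => [|x y xS yS|x xS] //.
    by rewrite mem_head.
  by rewrite maxEle; case: ifP.
suff -> : fem_kappa c xi h N = m by [].
apply/eqP; rewrite eq_le; apply/andP; split.
  by apply: ge_sup => //; exists m.
by apply: ub_le_sup => //; exists m.
Qed.

(* Main.v *)
Require Import Defs.
From HB Require Import structures.
From mathcomp Require Import all_boot all_order all_algebra.
From mathcomp Require Import all_classical all_reals all_analysis.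
From mathcomp Require Import complex.
From mathcomp Require Import ring lra zify.
Set Implicit Arguments.
Unset Strict Implicit.
Unset Printing Implicit Defensive.
Import Order.TTheory GRing.Theory Num.Theory numFieldNormedType.Exports.
Local Open Scope ring_scope.

(* Put s = L / c.  The energy E satisfies E' = - xi |v'_{N+1}|^2, so it does not
   increase.  For fixed N the system is observable from v'_{N+1} on any time
   interval, hence E (t + s) <= rho E t for some rho < 1 that depends on the
   parameters only.  Then E t <= exp (delta (s - t)) E 0 as soon as
   exp (- delta s) >= rho, and exp (delta s) <= (c + delta L) / (c - delta L).
   As delta may be taken this small, kappa enters only through kappa >= 0.

   Observability: a functional of the solution is negligible if its square is
   at most eta E + C (E t - E (t + s)) with eta > 0 arbitrary.  The negligible
   functionals contain v'_{N+1} and are closed under time derivatives (mean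
   value theorem and boundedness of all derivatives by the energy).  With
   r = 6 c^2 / h^2 and P = d^2/dt^2 - r, the scheme reads
     P v_{j-1} + (4 P + 6 r) v_j + P v_{j+1} = 0;
   if v'_{J+1} and P v'_J are negligible, then
   P^k v'_{J-k} = (- 6 r)^k v'_J modulo negligible functionals, and k = J
   together with v_0 = 0 shows that v'_J is negligible. *)

(** * Algebra of the scheme *)

(** Summation by parts: node [j] multiplied by [12 * u j] telescopes and leaves only the flux at
    [N.+1]. If [a] and [u] are the time derivatives of [u] and [x], the summand is the derivative of
    the energy density; for [g = 0] and [a = u] it gives coercivity of the mass matrix. *)
Lemma flux_sum (R : realFieldType) (N : nat) (u a x : nat -> R) (g : R) :
  u 0 = 0 ->
  (forall j, (1 <= j <= N)%N ->
     (a j.+1 + 4 * a j + a j.-1) / 6 - g * (x j.+1 - 2 * x j + x j.-1) = 0) ->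
  \sum_(0 <= j < N.+1)
     (4 * (u j * a j) + 2 * ((u j + u j.+1) * (a j + a j.+1))
      + 12 * g * ((x j.+1 - x j) * (u j.+1 - u j))) =
  u N.+1 * (2 * (a N.+1 + a N) + 12 * g * (x N.+1 - x N)).
Proof.
move=> u0; elim: N => [|N IHN] eqs.
  by rewrite big_nat1 u0; ring.
rewrite big_nat_recr //= IHN => [|j /andP[j0 jN]]; last first.
  by apply: eqs; rewrite j0 ltnW.
have /= e := eqs N.+1 (ltac:(by rewrite leqnn)).
apply/eqP; rewrite -subr_eq0; apply/eqP.
rewrite [LHS](_ : _ = 12 * u N.+1 * ((a N.+2 + 4 * a N.+1 + a N) / 6
  - g * (x N.+2 - 2 * x N.+1 + x N))); last by field.
by rewrite e mulr0.
Qed.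

(** Row [l] belongs to node [l.+1]: the clamped node 0 has no row, and row [N] is the free end. *)
Definition mass_row (R : fieldType) (N : nat) (u : nat -> R) (l : nat) : R :=
  if l == N then (2 * u N.+1 + u N) / 6 else (u l.+2 + 4 * u l.+1 + u l) / 6.

(** Positive definiteness: in [flux_sum] with [a = x = u] and [g = 0] the left side is a sum of
    squares and the right side is [- 2 * u N.+1 ^+ 2], so both vanish. *)
Lemma mass_row_inj (R : realFieldType) (N : nat) (u : nat -> R) :
  u 0 = 0 -> (forall l : 'I_N.+1, mass_row N u l = 0) ->
  forall i : 'I_N.+1, u i.+1 = 0.
Proof.
move=> u0 Mu.
have MuN : (2 * u N.+1 + u N) / 6 = 0 by have := Mu ord_max; rewrite /mass_row eqxx.
have /(flux_sum u0) : forall j, (1 <= j <= N)%N ->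
     (u j.+1 + 4 * u j + u j.-1) / 6 - 0 * (u j.+1 - 2 * u j + u j.-1) = 0.
  case=> // j /= jN; have := Mu (Ordinal (ltnW (jN : (j.+1 < N.+1)%N))).
  by rewrite /mass_row /= ltn_eqF// mul0r subr0.
rewrite [RHS](_ : _ = u N.+1 * (12 * ((2 * u N.+1 + u N) / 6)) - 2 * u N.+1 ^+ 2);
  last by field.
rewrite MuN !mulr0 sub0r => sumE.
have sum_ge0 (j : nat) : 0 <= 4 * (u j * u j) + 2 * ((u j + u j.+1) * (u j + u j.+1))
    + 0 * ((u j.+1 - u j) * (u j.+1 - u j)).
  rewrite mul0r addr0 -!expr2.
  by have := sqr_ge0 (u j); have := sqr_ge0 (u j + u j.+1); lra.
have S0 : u N.+1 ^+ 2 = 0.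
  apply/eqP; rewrite eq_le sqr_ge0 andbT.
  have : 0 <= - (2 * u N.+1 ^+ 2).
    by rewrite -sumE; apply: sumr_ge0 => j _; exact: sum_ge0.
  by rewrite oppr_ge0 pmulr_rle0.
have uN : u N.+1 = 0 by apply/eqP; rewrite -sqrf_eq0 S0.
move=> i; have [iN|iN] := ltnP i N; last first.
  by rewrite (_ : nat_of_ord i = N) //; apply/eqP; rewrite eqn_leq iN -ltnS ltn_ord.
move: sumE; rewrite S0 mulr0 oppr0 big_mkord => /eqP.
rewrite psumr_eq0 // => /allP /(_ (Ordinal (iN : (i.+1 < N.+1)%N))).
rewrite mem_index_enum => /(_ isT) /=.
rewrite mul0r addr0 -!expr2 => /eqP e; apply/eqP; rewrite -sqrf_eq0; apply/eqP.
by have := sqr_ge0 (u i.+1); have := sqr_ge0 (u i.+1 + u i.+2); lra.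
Qed.

(** [K] is the inverse mass matrix. One direction expresses accelerations by forces, the other
    recovers the scheme from that expression. *)
Lemma mass_inverse (R : realFieldType) (N : nat) :
  exists K : 'M[R]_N.+1, forall (u f : nat -> R), u 0 = 0 ->
    (forall l : 'I_N.+1, mass_row N u l = f l) <->
    (forall i : 'I_N.+1, u i.+1 = \sum_l K i l * f l).
Proof.
pose M : 'M[R]_N.+1 := \matrix_(l, i) mass_row N (fun j => (j == i.+1)%:R) l.
have ME u (l : 'I_N.+1) : u 0 = 0 ->
    mass_row N u l = (M *m \col_i (u i.+1)) l 0.
  move=> u0.
  have uE j : (j <= N.+1)%N -> u j = \sum_(i < N.+1) (j == i.+1)%:R * u i.+1.
    case: j => [|j] jN.
      by rewrite big1 // => i _; rewrite mul0r.
    rewrite (bigD1 (Ordinal jN)) //= eqxx mul1r big1 ?addr0 // => i.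
    rewrite -val_eqE /= eqSS eq_sym => /negbTE ->.
    by rewrite mul0r.
  rewrite mxE /mass_row.
  under [RHS]eq_bigr => i _ do rewrite !mxE /mass_row.
  case: eqP => lN.
    rewrite (uE N.+1) // (uE N) // mulr_sumr -big_split mulr_suml.
    by apply: eq_bigr => i _ /=; ring.
  have lN' : (l < N)%N by rewrite ltn_neqAle -ltnS ltn_ord andbT; apply/eqP.
  rewrite (uE l.+2) // (uE l.+1) ?(uE l) ?(ltnW lN') //; try lia.
  rewrite mulr_sumr -!big_split mulr_suml.
  by apply: eq_bigr => i _ /=; ring.
have Mu : M \in unitmx.
  rewrite -unitmx_tr -row_free_unit -kermx_eq0; apply/rowV0P => v /sub_kermxP vM.
  pose u j := if j is j'.+1 then v 0 (inord j') else 0.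
  have uE : \col_i (u i.+1) = v^T.
    by apply/matrixP => i j; rewrite !mxE /= inord_val ord1.
  have /mass_row_inj u0 : forall l : 'I_N.+1, mass_row N u l = 0.
    by move=> l; rewrite ME // uE -[M]trmxK -trmx_mul vM !mxE.
  apply/rowP => i; rewrite mxE.
  by have := u0 erefl i; rewrite /= inord_val.
exists (invmx M) => u f u0; split=> H.
  move=> i; have -> : u i.+1 = (invmx M *m (M *m \col_i (u i.+1))) i 0.
    by rewrite mulKmx // mxE.
  by rewrite mxE; apply: eq_bigr => l _; rewrite -ME // H.
move=> l; rewrite ME //.
have -> : \col_i (u i.+1) = invmx M *m \col_l f l.
  apply/colP => i; rewrite !mxE H; apply: eq_bigr => j _; by rewrite mxE.
by rewrite mulKVmx // mxE.
Qed.

(* P^k (a (J - k)) = (- r)^k (a J) modulo S by induction on k, and a 0 = 0. *)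
Lemma chain_closed (R : fieldType) (V : lmodType R) (P : {linear V -> V})
    (S : V -> Prop) (r : R) (J : nat) (a : nat -> V) :
  r != 0 ->
  (forall x y f g, S f -> S g -> S (x *: f + y *: g)) ->
  (forall f, S f -> S (P f)) ->
  a 0 = 0 -> S (a J.+1) -> S (P (a J)) ->
  (forall j, (1 <= j <= J)%N ->
     P (a j.+1) + (4 *: P (a j) + r *: a j) + P (a j.-1) = 0) ->
  S (a J).
Proof.
move=> r0 Slin SP a0 SJ1 SPJ eqs.
have Sadd f g : S f -> S g -> S (f + g).
  by move=> Sf Sg; rewrite -[f]scale1r -[g]scale1r; exact: Slin.
have SZ x f : S f -> S (x *: f).
  by move=> Sf; rewrite -[_ *: _]addr0 -(scale0r f); exact: Slin.
have PnD n f g : iter n P (f + g) = iter n P f + iter n P g.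
  by elim: n => //= n ->; rewrite linearD.
have PnZ n x f : iter n P (x *: f) = x *: iter n P f.
  by elim: n => //= n ->; rewrite linearZ.
have Pn0 n : iter n P 0 = 0 by elim: n => //= n ->; rewrite linear0.
pose D k := iter k P (a (J - k)%N) - (- r) ^+ k *: a J.
(* [P (a J)] lies in [S], so one more [P] removes the main term of [D k]. *)
have SPa k : S (D k) -> S (P (iter k P (a (J - k)%N))).
  move=> /SP; rewrite /D linearB linearZ /= => SDk.
  rewrite -[P _](subrK ((- r) ^+ k *: P (a J))).
  by apply: (Sadd) => //; apply: SZ.
have SD k : (k <= J)%N -> S (D k).
  (* The recurrence has three terms, so the induction carries the predecessor of [D k] as well. *)
  suff: (k <= J)%N -> S (D k) /\ (forall m, k = m.+1 -> S (D m)).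
    by move=> H /H[].
  elim: k => [|k IHk] kJ.
    split=> //; rewrite /D subn0 expr0 scale1r subrr -(scale0r (a J.+1)).
    exact: SZ.
  have [SDk SDk1] := IHk (ltnW kJ).
  split=> [|m [<-] //].
  (* [P^k] applied to the recurrence at [J - k]: of the terms other than [P^(k+1) (a (J - k - 1))],
     the two with [P^(k+1)] lie in [S], and [r *: P^k (a (J - k))] supplies the new factor [- r]. *)
  have := eqs (J - k)%N; rewrite -subnS => /(_ ltac:(lia)).
  move=> /(congr1 (iter k P)); rewrite !PnD !PnZ.
  rewrite Pn0 -!iterSr => eqk.
  have SPk1 : S (iter k.+1 P (a (J - k).+1)).
    case: k {IHk SDk eqk} SDk1 kJ => [|k] SDk1 kJ.
      by rewrite subn0 /=; exact: SP.
    rewrite subnSK; last by lia.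
    by rewrite iterS; apply: SP; rewrite iterS; apply/SPa/SDk1.
  rewrite /D (_ : iter k.+1 P (a (J - k.+1)%N) =
     - 1 *: iter k.+1 P (a (J - k).+1) +
      (- 4 *: iter k.+1 P (a (J - k)%N) + (- r) *: iter k P (a (J - k)%N)));
    last first.
    apply/eqP; rewrite -subr_eq0 -[X in _ == X]eqk scaleN1r !scaleNr.
    rewrite !opprD !opprK addrC; apply/eqP; congr (_ + _).
  rewrite -addrA; apply: (Sadd); first exact: SZ.
  rewrite -addrA; apply: (Sadd); first by apply: (SZ); rewrite iterS; exact: SPa.
  by rewrite exprS -scalerA -scalerBr; apply: SZ.
(* At [k = J] the term [P^J (a 0)] vanishes and [D J] is a nonzero multiple of [a J]. *)
have := SZ (- (- r) ^- J) _ (SD J (leqnn _)).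
rewrite /D subnn a0 Pn0.
by rewrite sub0r scalerN scaleNr opprK scalerA mulVf ?scale1r ?expf_neq0 ?oppr_eq0.
Qed.

(** * Negligible functions *)

(* With E = 0 this says that Q is bounded by a multiple of D. *)
Definition negligible (R : realFieldType) (X : Type) (E D Q : X -> R) : Prop :=
  forall eta, 0 < eta ->
    exists2 C, 0 <= C & forall z, Q z <= eta * E z + C * D z.

Section Negligible.
Variables (R : realFieldType) (X : Type) (E D : X -> R).
Hypothesis E_ge0 : forall z, 0 <= E z.

Lemma negligible_le (Q1 Q2 : X -> R) :
  (forall z, Q1 z <= Q2 z) -> negligible E D Q2 -> negligible E D Q1.
Proof.
move=> le12 nQ eta /nQ[C C0 HC]; exists C => // z.
exact: le_trans (le12 z) (HC z).
Qed.

Lemma negligibleD (Q1 Q2 : X -> R) : negligible E D Q1 -> negligible E D Q2 ->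
  negligible E D (fun z => Q1 z + Q2 z).
Proof.
move=> nQ1 nQ2 eta eta0; have eta20 : 0 < eta / 2 by lra.
have [C1 C10 H1] := nQ1 _ eta20; have [C2 C20 H2] := nQ2 _ eta20.
exists (C1 + C2) => [|z]; first lra.
by have := H1 z; have := H2 z; lra.
Qed.

Lemma negligibleZ (x : R) (Q : X -> R) : 0 <= x -> negligible E D Q ->
  negligible E D (fun z => x * Q z).
Proof.
(* Dividing [eta] by [x + 1] instead of [x] covers [x = 0]. *)
move=> x0 nQ eta eta0; have x10 : 0 < x + 1 by lra.
have [C C0 H] := nQ _ (divr_gt0 eta0 x10).
exists (x * C) => [|z]; first exact: mulr_ge0.
apply: le_trans (ler_wpM2l x0 (H z)) _.
rewrite mulrDr [x * (C * _)]mulrA lerD2r mulrA ler_wpM2r //.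
by rewrite mulrCA ler_piMr ?(ltW eta0) // ler_pdivrMr // mul1r; lra.
Qed.

Lemma negligible_sum (n : nat) (Q : nat -> X -> R) :
  (forall j, (j < n)%N -> negligible E D (Q j)) ->
  negligible E D (fun z => \sum_(0 <= j < n) Q j z).
Proof.
elim: n => [|n IHn] nQ.
  move=> eta eta0; exists 0 => // z.
  by rewrite big_geq // mul0r addr0 mulr_ge0 // ltW.
have := negligibleD (IHn (fun j jn => nQ j (ltnW jn))) (nQ n (ltnSn n)).
by apply: negligible_le => z; rewrite big_nat_recr.
Qed.

(** Functionals with negligible square form a vector space, because [(p + q)^2 <= 2 p^2 + 2 q^2]. *)
Lemma negligible_sqr_lin (x y : R) (f g : X -> R) :
  negligible E D (fun z => f z ^+ 2) -> negligible E D (fun z => g z ^+ 2) ->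
  negligible E D (fun z => (x * f z + y * g z) ^+ 2).
Proof.
move=> nf ng.
have x2 : 0 <= 2 * x ^+ 2 by rewrite mulr_ge0 ?sqr_ge0.
have y2 : 0 <= 2 * y ^+ 2 by rewrite mulr_ge0 ?sqr_ge0.
apply: negligible_le (negligibleD (negligibleZ x2 nf) (negligibleZ y2 ng)) => z.
rewrite -subr_ge0 [leRHS](_ : _ = (x * f z - y * g z) ^+ 2) ?sqr_ge0 //; ring.
Qed.

Lemma negligible_sqr_sum (n : nat) (x : 'I_n -> R) (f : 'I_n -> X -> R) :
  (forall l, negligible E D (fun z => f l z ^+ 2)) ->
  negligible E D (fun z => (\sum_l x l * f l z) ^+ 2).
Proof.
elim: n x f => [|n IHn] x f nf.
  move=> eta eta0; exists 0 => // z.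
  by rewrite big_ord0 expr0n /= mul0r addr0 mulr_ge0 // ltW.
have IH := IHn (fun l => x (lift ord0 l)) (fun l => f (lift ord0 l))
  (fun l => nf (lift ord0 l)).
have := negligible_sqr_lin (x ord0) 1 (nf ord0) IH.
by apply: negligible_le => z; rewrite big_ord_recl mul1r.
Qed.

End Negligible.

(** * Mean value theorem and derivatives of finite sums *)

Lemma mean_value (R : realType) (f df : R -> R) (a b : R) :
  (forall t : R, 0 < t -> is_derive t 1 f (df t)) -> 0 < a -> a < b ->
  exists2 t, a < t < b & f b - f a = df t * (b - a).
Proof.
move=> dfE a0 ab.
have [||t tab ->] := @MVT R f df a b ab.
- by move=> t; rewrite in_itv /= => /andP[/(lt_trans a0) + _]; exact: dfE.
- apply: derivable_within_continuous => t; rewrite in_itv /= => /andP[+ _].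
  by move=> /(lt_le_trans a0) /dfE[].
by exists t => //; rewrite in_itv in tab.
Qed.

Lemma is_derive_sum_nat (R : realType) (n : nat) (f : nat -> R -> R)
    (df : nat -> R) (t : R) :
  (forall j, (j < n)%N -> is_derive t 1 (f j) (df j)) ->
  is_derive t 1 (fun u => \sum_(0 <= j < n) f j u) (\sum_(0 <= j < n) df j).
Proof.
elim: n => [|n IHn] fE.
  rewrite big_geq // (_ : (fun u => _) = cst 0); last first.
    by apply/funext => u; rewrite big_geq.
  exact: is_derive_cst.
rewrite big_nat_recr //= (_ : (fun u => _) = (fun u => \sum_(0 <= j < n) f j u) + f n).
  by apply: is_deriveD; [apply: IHn => j jn; apply/fE/ltnW|exact: fE].
by apply/funext => u; rewrite big_nat_recr.
Qed.

(** * Solutions and all their time derivatives *)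

(* w k j is the k-th time derivative of v_j; only positive times are
   constrained, g = c^2 / h^2 and d = xi / h. *)
Record fem_jet (R : realType) (g d : R) (N : nat) (w : nat -> nat -> R -> R) :
    Prop := FemJet {
  jet_derive : forall k j (t : R), 0 < t ->
    is_derive t 1 (w k j) (w k.+1 j t) ;
  jet_left : forall k t, w k 0 t = 0 ;
  jet_interior : forall k j t, (1 <= j <= N)%N -> 0 < t ->
    (w k.+2 j.+1 t + 4 * w k.+2 j t + w k.+2 j.-1 t) / 6
    - g * (w k j.+1 t - 2 * w k j t + w k j.-1 t) = 0 ;
  jet_right : forall k t, 0 < t ->
    (2 * w k.+2 N.+1 t + w k.+2 N t) / 6 + g * (w k N.+1 t - w k N t)
    = - d * w k.+1 N.+1 t
}.

(* The energy without its factor h / 12. *)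
Definition jet_energy (R : realType) (g : R) (N : nat)
    (w : nat -> nat -> R -> R) (t : R) : R :=
  w 1 N.+1 t ^+ 2
  + \sum_(0 <= j < N.+1)
      (2 * w 1 j t ^+ 2 + (w 1 j t + w 1 j.+1 t) ^+ 2
       + 6 * g * (w 0 j.+1 t - w 0 j t) ^+ 2).

Section JetEnergy.
Variables (R : realType) (g d : R) (N : nat).
Hypotheses (g_gt0 : 0 < g) (d_gt0 : 0 < d).

Lemma jet_density_ge0 (w : nat -> nat -> R -> R) (t : R) j :
  0 <= 2 * w 1 j t ^+ 2 + (w 1 j t + w 1 j.+1 t) ^+ 2
       + 6 * g * (w 0 j.+1 t - w 0 j t) ^+ 2 :> R.
Proof.
by rewrite !addr_ge0 ?sqr_ge0 // mulr_ge0 ?sqr_ge0 ?mulr_ge0 // ltW.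
Qed.

Lemma jet_energy_ge0 (w : nat -> nat -> R -> R) (t : R) : 0 <= jet_energy g N w t.
Proof.
by rewrite addr_ge0 ?sqr_ge0 //; apply: sumr_ge0 => j _; exact: jet_density_ge0.
Qed.

Lemma jet_energy_ge_density (w : nat -> nat -> R -> R) (t : R) j : (j <= N)%N ->
  2 * w 1 j t ^+ 2 + (w 1 j t + w 1 j.+1 t) ^+ 2
       + 6 * g * (w 0 j.+1 t - w 0 j t) ^+ 2 <= jet_energy g N w t.
Proof.
move=> jN; rewrite /jet_energy big_mkord (bigD1 (Ordinal (jN : (j < N.+1)%N))) //=.
rewrite addrCA lerDl addr_ge0 ?sqr_ge0 //.
by apply: sumr_ge0 => i _; exact: jet_density_ge0.
Qed.

Lemma is_derive_density (a b x y : R -> R) (da db dx dy t : R) :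
  is_derive t 1 a da -> is_derive t 1 b db ->
  is_derive t 1 x dx -> is_derive t 1 y dy ->
  is_derive t 1
    (fun u => 2 * a u ^+ 2 + (a u + b u) ^+ 2 + 6 * g * (y u - x u) ^+ 2)
    (4 * (a t * da) + 2 * ((a t + b t) * (da + db))
      + 12 * g * ((y t - x t) * (dy - dx))).
Proof.
move=> Da Db Dx Dy.
rewrite (_ : (fun u => _) =
    2 *: a ^+ 2 + (a + b) ^+ 2 + (6 * g) *: (y - x) ^+ 2); last first.
  by apply/funext => u; rewrite !fctE.
have D2 := is_deriveD (is_deriveD (is_deriveZ 2 (is_deriveX 2 Da))
  (is_deriveX 2 (is_deriveD Da Db)))
  (is_deriveZ (6 * g) (is_deriveX 2 (is_deriveB Dy Dx))).
rewrite /GRing.scale /= !fctE !expr1 in D2.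
apply: is_derive_eq D2 _; ring.
Qed.

(** The extra term [w 1 N.+1 t ^+ 2] of the energy completes the flux left by [flux_sum] to
    [12 * w 1 N.+1 t] times the left side of the boundary equation, which equals the damping. The
    factor [h / 12] turns [12 * d] into [xi]. *)
Lemma jet_energy_derive (w : nat -> nat -> R -> R) (t : R) :
  fem_jet g d N w -> 0 < t ->
  is_derive t 1 (jet_energy g N w) (- (12 * d) * w 1 N.+1 t ^+ 2).
Proof.
move=> jw t0; have dw k j := jet_derive jw k j t0.
have dS := is_derive_sum_nat (n := N.+1)
  (fun j _ => is_derive_density (dw 1 j) (dw 1 j.+1) (dw 0 j) (dw 0 j.+1)).
have DE := is_deriveD (is_deriveX 2 (dw 1 N.+1)) dS.
apply: is_derive_eq DE _.
rewrite (flux_sum (u := fun j => w 1 j t) (a := fun j => w 2 j t)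
  (x := fun j => w 0 j t) (jet_left jw 1 t)
  (fun j jN => jet_interior jw 0 jN t0)).
have := jet_right jw 0 t0.
rewrite /GRing.scale /= expr1 => e.
rewrite [LHS](_ : _ = 12 * w 1 N.+1 t * ((2 * w 2 N.+1 t + w 2 N t) / 6
  + g * (w 0 N.+1 t - w 0 N t))); last by field.
by rewrite e; ring.
Qed.

End JetEnergy.

Section JetBounds.
Variables (R : realType) (g d : R) (N : nat).
Hypotheses (g_gt0 : 0 < g) (d_gt0 : 0 < d).

Lemma jet_energy_nincr (w : nat -> nat -> R -> R) (a b : R) :
  fem_jet g d N w -> 0 < a -> a <= b -> jet_energy g N w b <= jet_energy g N w a.
Proof.
move=> jw a0; rewrite le_eqVlt => /predU1P[->//|ab].
have [t _ e] := mean_value (df := fun t => - (12 * d) * w 1 N.+1 t ^+ 2)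
  (fun t => jet_energy_derive jw) a0 ab.
rewrite -subr_le0 e mulNr mulNr oppr_le0.
by rewrite mulr_ge0 ?subr_ge0 ?(ltW ab) // mulr_ge0 ?sqr_ge0 // mulr_ge0 // ltW.
Qed.

(** Solution and time form one point, so the constants in [negligible] are uniform in both. *)
Record jet_point := JetPoint {
  jp_jet : nat -> nat -> R -> R ;
  jp_time : R ;
  jp_jetP : fem_jet g d N jp_jet ;
  jp_time_gt0 : 0 < jp_time }.

(** Induction on the order: the energy contains strains and velocities; the scheme expresses the
    mass rows of order [k.+2] by strains of order [k] and the end velocity of order [k.+1], and the
    inverse mass matrix then bounds each node. *)
Lemma jet_bounded (k : nat) :
  let bounded f := negligible (fun=> 0)
    (fun z => jet_energy g N (jp_jet z) (jp_time z))
    (fun z : jet_point => f (jp_jet z) (jp_time z) ^+ 2) in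
  (forall j, (j <= N)%N -> bounded (fun w t => w k j.+1 t - w k j t)) /\
  (forall j, (j <= N.+1)%N -> bounded (fun w t => w k.+1 j t)).
Proof.
move=> bounded.
have lin x y f h : bounded f -> bounded h ->
    bounded (fun w t => x * f w t + y * h w t).
  by apply: negligible_sqr_lin.
have ext f h : (forall w t, fem_jet g d N w -> 0 < t -> f w t = h w t) ->
    bounded h -> bounded f.
  move=> fh; apply: negligible_le => z.
  by rewrite fh //; [exact: jp_jetP|exact: jp_time_gt0].
have [K KE] := mass_inverse R N.
elim: k => [|k [IHD IHw]].
  split=> [j jN|j jN] eta eta0.
    exists (6 * g)^-1 => [|z].
      by rewrite invr_ge0 mulr_ge0 // ltW.
    rewrite mulr0 add0r mulrC ler_pdivlMr; last by rewrite mulr_gt0.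
    have := jet_energy_ge_density g_gt0 (jp_jet z) (jp_time z) jN.
    set w := jp_jet z; set t := jp_time z.
    by have := sqr_ge0 (w 1 j t); have := sqr_ge0 (w 1 j t + w 1 j.+1 t); lra.
  exists 1 => // z; rewrite mulr0 add0r mul1r.
  move: jN; rewrite leq_eqVlt => /predU1P[->|jN].
    rewrite /jet_energy lerDl; apply: sumr_ge0 => i _.
    exact: jet_density_ge0.
  have := jet_energy_ge_density g_gt0 (jp_jet z) (jp_time z) (jN : (j <= N)%N).
  apply: le_trans.
  set w := jp_jet z; set t := jp_time z.
  have : 0 <= 6 * g * (w 0 j.+1 t - w 0 j t) ^+ 2.
    by rewrite mulr_ge0 ?sqr_ge0 // mulr_ge0 // ltW.
  by have := sqr_ge0 (w 1 j t); have := sqr_ge0 (w 1 j t + w 1 j.+1 t); lra.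
have rowE (l : nat) : (l <= N)%N ->
    bounded (fun w t => mass_row N (fun j => w k.+2 j t) l).
  rewrite leq_eqVlt => /predU1P[->|lN].
    apply: ext (lin (- g) (- d) _ _ (IHD N (leqnn _)) (IHw N.+1 (leqnn _))) => w t jw t0.
    by have := jet_right jw k t0; rewrite /mass_row eqxx; lra.
  apply: ext (lin g (- g) _ _ (IHD l.+1 lN) (IHD l (ltnW lN))) => w t jw t0.
  have /= := jet_interior jw k (lN : (1 <= l.+1 <= N)%N) t0.
  by rewrite /mass_row ltn_eqF //; lra.
split=> [j jN|j jN].
  apply: ext (lin 1 (- 1) _ _ (IHw j.+1 jN) (IHw j (leqW jN))) => w t _ _.
  by ring.
case: j jN => [|i] iN.
  move=> eta eta0; exists 0 => // z.
  by rewrite (jet_left (jp_jetP z)) expr0n /= mulr0 mul0r addr0.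
have := negligible_sqr_sum (fun=> lexx 0)
  (K (Ordinal (iN : (i < N.+1)%N))) (fun l : 'I_N.+1 => rowE l (ltn_ord l)).
apply: negligible_le => z.
by rewrite (((KE (fun j => jp_jet z k.+2 j (jp_time z)) _
  (jet_left (jp_jetP z) _ _)).1 (fun=> erefl)) (Ordinal iN)).
Qed.

End JetBounds.

(** * Observability from the damped end *)

(** The mean value theorem bounds the squared increment from [f u] to [f t] by
    [(q - p) ^+ 2 * M]. *)
Lemma sqr_le_near (R : realType) (f df : R -> R) (p q M u t : R) :
  (forall t : R, 0 < t -> is_derive t 1 f (df t)) -> 0 < p ->
  (forall v, p <= v <= q -> df v ^+ 2 <= M) ->
  p <= t <= q -> p <= u <= q ->
  f t ^+ 2 <= 2 * f u ^+ 2 + 2 * (q - p) ^+ 2 * M.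
Proof.
move=> dfE p0 dfM.
have M0 : p <= q -> 0 <= M.
  by move=> pq; apply: le_trans (sqr_ge0 _) (dfM p _); rewrite lexx.
have main x y : p <= x -> x < y -> y <= q -> (f y - f x) ^+ 2 <= (q - p) ^+ 2 * M.
  move=> px xy yq; have [v /andP[xv vy] ->] := mean_value dfE (lt_le_trans p0 px) xy.
  rewrite exprMn mulrC ler_pM ?sqr_ge0 // ?dfM //; last by lra.
  by rewrite ler_sqr ?nnegrE; lra.
move=> /andP[pt tq] /andP[pu uq].
have : (f t - f u) ^+ 2 <= (q - p) ^+ 2 * M.
  have [tu|ut|->] := ltgtP t u.
  - by rewrite -sqrrN opprB main.
  - by rewrite main.
  - by rewrite subrr expr0n mulr_ge0 ?sqr_ge0 // M0 // (le_trans pu).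
have := sqr_ge0 (f t - f u - f u).
rewrite -[2 * _ ^+ 2 * M]mulrA.
set Z := (q - p) ^+ 2 * M => h1 h2.
rewrite (_ : f t ^+ 2 = 2 * f u ^+ 2 + 2 * (f t - f u) ^+ 2
  - (f t - f u - f u) ^+ 2); first lra.
ring.
Qed.

Section Observability.
Variables (R : realType) (g d s : R) (N : nat).
Hypotheses (g_gt0 : 0 < g) (d_gt0 : 0 < d) (s_gt0 : 0 < s).

(** Solution, window and time in the window form one point, so that observability constants depend
    on none of them. *)
Record jet_window := JetWindow {
  jw_jet : nat -> nat -> R -> R ;
  jw_start : R ;
  jw_time : R ;
  jw_jetP : fem_jet g d N jw_jet ;
  jw_start_gt0 : 0 < jw_start ;
  jw_itv : jw_start <= jw_time <= jw_start + s }.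

Definition start_energy z := jet_energy g N (jw_jet z) (jw_start z).

Definition energy_drop z :=
  start_energy z - jet_energy g N (jw_jet z) (jw_start z + s).

Definition obs_negligible (f : (nat -> nat -> R -> R) -> R -> R) : Prop :=
  negligible start_energy energy_drop
    (fun z => f (jw_jet z) (jw_time z) ^+ 2).

Lemma start_energy_ge0 z : 0 <= start_energy z.
Proof. exact: jet_energy_ge0. Qed.

(* Control at one time of every subinterval of length D is enough: a short D
   makes the variation of the functional negligible. *)
Lemma negligible_obs_window (k : nat) :
  (forall D : R, 0 < D -> D <= s -> forall eta : R, 0 < eta -> exists2 C : R, 0 <= C &
     forall z p, jw_start z <= p -> p + D <= jw_start z + s ->
     exists2 u, p < u < p + D &
       jw_jet z k.+1 N.+1 u ^+ 2 <= eta * start_energy z + C * energy_drop z) ->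
  obs_negligible (fun w t => w k.+1 N.+1 t).
Proof.
move=> H eta eta0.
have [B B0 HB] := (jet_bounded d N g_gt0 k.+1).2 N.+1 (leqnn _) 1 ltr01.
(* [D <= s / 2] leaves room for a subinterval of length [D] around any time of the window. The other
   two bounds give [2 * D ^+ 2 * B <= eta / 2]; the remaining [eta / 2] comes from twice the
   [eta / 4] granted at [u]. *)
pose D := Num.min (s / 2) (Num.min 1 (eta / (4 * (B + 1)))).
have e4 : 0 < eta / (4 * (B + 1)) by rewrite divr_gt0 // mulr_gt0 // ltr_wpDl.
have D0 : 0 < D by rewrite !lt_min e4 ltr01 divr_gt0.
have Ds : D <= s / 2 by rewrite ge_min lexx.
have D1 : D <= 1 by rewrite !ge_min lexx orbT.
have De : D <= eta / (4 * (B + 1)) by rewrite !ge_min lexx !orbT.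
have DB : 2 * D ^+ 2 * B <= eta / 2.
  have : D * (4 * (B + 1)) <= eta by rewrite -ler_pdivlMr // mulr_gt0 // ltr_wpDl.
  have : D ^+ 2 * B <= D * B by rewrite ler_wpM2r // expr2 ler_piMr // ltW.
  by lra.
have [C C0 HC] := H D D0 (ltac:(lra)) (eta / 4) (ltac:(lra)).
exists (2 * C) => [|z]; first lra.
case: z => w a t jw a0 itv; set z := JetWindow _ _ _.
have /andP[ta tas] := itv; rewrite /=.
have [p /andP[ap pD] tp] : exists2 p, (a <= p) && (p + D <= a + s) & p <= t <= p + D.
  have [tD|tD] := leP (t + D) (a + s).
    by exists t; [rewrite tD andbT | lra].
  by exists (t - D); [apply/andP; split; lra | lra].
have [u /andP[pu uD] Hu] := HC z p ap pD.
have p0 : 0 < p by apply: lt_le_trans ap.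
have M v : p <= v <= p + D -> w k.+2 N.+1 v ^+ 2 <= B * start_energy z.
  move=> /andP[pv _]; have v0 : 0 < v by lra.
  have := HB (JetPoint jw v0); rewrite mulr0 add0r /= => /le_trans; apply.
  apply: ler_wpM2l => //; apply: (jet_energy_nincr d_gt0 jw) => //.
  exact: le_trans pv.
have := sqr_le_near (fun t => @jet_derive _ _ _ _ _ jw k.+1 N.+1 t) p0 M tp
   (_ : p <= u <= p + D).
move=> /(_ ltac:(by rewrite !ltW)); rewrite addrAC subrr add0r.
have := ler_wpM2r (start_energy_ge0 z) DB.
move: Hu; rewrite /= mulrA; lra.
Qed.

(** Mean value theorem on a short interval. For the velocity it is applied to the energy: at some
    [u] the dissipation equals the energy lost divided by [D]. For higher orders it is applied to
    the preceding derivative, whose two end values are negligible. *)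
Lemma negligible_obs (k : nat) : obs_negligible (fun w t => w k.+1 N.+1 t).
Proof.
elim: k => [|k IHk]; apply: negligible_obs_window => D D0 Ds eta eta0.
  have dD : 0 < 12 * d * D by rewrite !mulr_gt0.
  exists (12 * d * D)^-1 => [|z p ap pD]; first by rewrite invr_ge0 ltW.
  have jw := jw_jetP z; have a0 := jw_start_gt0 z.
  have p0 := lt_le_trans a0 ap.
  have [u uI e] := mean_value (df := fun t => - (12 * d) * jw_jet z 1 N.+1 t ^+ 2)
    (fun t => jet_energy_derive jw) p0 (ltac:(lra) : p < p + D).
  exists u => //.
  have E1 := jet_energy_nincr d_gt0 jw a0 ap.
  have E2 := jet_energy_nincr d_gt0 jw (ltac:(lra) : 0 < p + D) pD.
  have := mulr_ge0 (ltW eta0) (start_energy_ge0 z).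
  suff : jw_jet z 1 N.+1 u ^+ 2 <= (12 * d * D)^-1 * energy_drop z by lra.
  rewrite mulrC ler_pdivlMr // /energy_drop /start_energy.
  move: e; rewrite (_ : p + D - p = D); last by ring.
  by lra.
have e2 : 0 < D ^+ 2 by rewrite exprn_gt0.
(* The difference quotient costs [D ^- 2], and [(x - y)^2 <= 2 x^2 + 2 y^2] over two end values
   costs 4. *)
have [C C0 HC] := IHk (eta * D ^+ 2 / 4) (ltac:(by rewrite divr_gt0 // mulr_gt0)).
exists (4 * C / D ^+ 2) => [|z p ap pD]; first by apply: divr_ge0; [lra|exact: sqr_ge0].
have a0 := jw_start_gt0 z; have p0 := lt_le_trans a0 ap; have jw := jw_jetP z.
have [u uI e] := mean_value (fun t => @jet_derive _ _ _ _ _ jw k.+1 N.+1 t) p0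
  (ltac:(lra) : p < p + D).
exists u => //.
have I1 : jw_start z <= p <= jw_start z + s by apply/andP; split; lra.
have I2 : jw_start z <= p + D <= jw_start z + s by apply/andP; split; lra.
have := HC (JetWindow jw a0 I1); have := HC (JetWindow jw a0 I2).
rewrite /energy_drop /start_energy /=.
set E1 := jet_energy _ _ _ _; set E2 := _ - _.
move: e; rewrite (_ : p + D - p = D); last by ring.
set x := jw_jet z k.+1 N.+1 (p + D); set y := jw_jet z k.+1 N.+1 p.
set v := jw_jet z k.+2 N.+1 u => e hx hy.
have h : (v * D) ^+ 2 <= 2 * x ^+ 2 + 2 * y ^+ 2.
  by rewrite -e; have := sqr_ge0 (x + y); lra.
rewrite -(ler_pM2r e2) -exprMn; apply: le_trans h _.
rewrite [leRHS]mulrDl (_ : 4 * C / D ^+ 2 * E2 * D ^+ 2 = 4 * (C * E2)); last first.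
  by field; rewrite gt_eqF.
by lra.
Qed.

(** A functional is encoded as the sequence of its time derivatives. Differentiating twice is then a
    shift by two, and [d^2/dt^2 - r] is linear on all sequences. *)
Definition shift_sub (X : Type) (r : R) (f : nat -> X -> R) : nat -> X -> R :=
  fun k z => f k.+2 z - r * f k z.

Lemma shift_sub_linear (X : Type) r : linear (@shift_sub X r).
Proof.
move=> x f h; apply/funext => k; apply/funext => z.
by rewrite /shift_sub !fctE /= /GRing.scale /=; ring.
Qed.

HB.instance Definition _ (X : Type) r := GRing.isLinear.Build R (nat -> X -> R)
  (nat -> X -> R) _ (@shift_sub X r) (@shift_sub_linear X r).

Lemma negligible_velocity (j k : nat) : (j <= N.+1)%N ->
  obs_negligible (fun w t => w k.+1 j t).
Proof.
pose S (f : nat -> jet_window -> R) :=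
  forall k, negligible start_energy energy_drop (fun z => f k z ^+ 2).
pose a j : nat -> jet_window -> R := fun k z => jw_jet z k.+1 j (jw_time z).
pose P := @shift_sub jet_window (6 * g).
(* Induction from the damped end towards node 0. The pair is what [chain_closed] requires at
   [J = N - i]; [S] involves all time derivatives, hence is stable under [P]. *)
suff H i : (i <= N)%N -> S (a (N - i).+1) /\ S (P (a (N - i)%N)).
  case: j => [|j] jN.
    move=> eta eta0; exists 0 => // z.
    rewrite (jet_left (jw_jetP z)) expr0n /= mul0r addr0.
    by rewrite mulr_ge0 ?start_energy_ge0 // ltW.
  by have [/(_ k)] := H (N - j)%N (leq_subr _ _); rewrite subKn.
have time_gt0 z : 0 < jw_time z.
  by have /andP[+ _] := jw_itv z; apply: lt_le_trans; exact: jw_start_gt0.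
have Slin x y f h : S f -> S h -> S (x *: f + y *: h).
  move=> Sf Sh k'; apply: (negligible_sqr_lin start_energy_ge0 x y (Sf k') (Sh k')).
have SP f : S f -> S (P f).
  move=> Sf k'.
  have := negligible_sqr_lin start_energy_ge0 1 (- (6 * g)) (Sf k'.+2) (Sf k').
  by apply: negligible_le => z; rewrite /P /shift_sub mul1r mulNr.
have g6 : 6 * (6 * g) != 0 by rewrite !mulf_neq0 // gt_eqF.
have eqs m : (1 <= m <= N)%N ->
    P (a m.+1) + (4 *: P (a m) + (6 * (6 * g)) *: a m) + P (a m.-1) = 0.
  move=> mN; apply/funext => k'; apply/funext => z.
  have := jet_interior (jw_jetP z) k'.+1 mN (time_gt0 z).
  by rewrite /P /shift_sub /a !fctE /= /GRing.scale /=  => e; rewrite -[RHS]/(0 : R); lra.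
elim: i => [|i IHi] iN.
  rewrite subn0; split=> k'; first exact: negligible_obs.
  (* The boundary equation, solved for [P] at node [N], contains only derivatives at the observed
     node [N.+1]. *)
  have := negligible_sqr_lin start_energy_ge0 1 (- (6 * d))
    (negligible_sqr_lin start_energy_ge0 (- 2) (- (6 * g))
      (negligible_obs k'.+2) (negligible_obs k')) (negligible_obs k'.+1).
  apply: negligible_le => z.
  have := jet_right (jw_jetP z) k'.+1 (time_gt0 z).
  rewrite /P /shift_sub /a => e; rewrite le_eqVlt; apply/orP; left; apply/eqP.
  by congr (_ ^+ 2); lra.
have [S1 S2] := IHi (ltnW iN).
have Ni : (N - i = (N - i.+1).+1)%N by rewrite -subSn.
(* The coefficient [r] of [chain_closed] is here [36 * g]. *)
have S3 : S (a (N - i)%N).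
  apply: (chain_closed (P := P) g6 Slin SP) => //.
    apply/funext => k'; apply/funext => z; exact: (jet_left (jw_jetP z)).
  by move=> m /andP[m0 mN]; apply: eqs; rewrite m0 (leq_trans mN) ?leq_subr.
rewrite -Ni; split=> //.
(* The interior equation at node [N - i], solved for its left neighbour. *)
have -> : P (a (N - i.+1)%N) = - 1 *: P (a (N - i).+1) +
    1 *: ((- 4) *: P (a (N - i)%N) + (- (6 * (6 * g))) *: a (N - i)%N).
  have := eqs (N - i)%N ltac:(lia); rewrite -subnS => e.
  apply/eqP; rewrite -subr_eq0 -[X in _ == X]e scale1r scaleN1r !scaleNr.
  by rewrite !opprD !opprK addrC.
by apply: (Slin) => //; [exact: SP|apply: Slin => //; exact: SP].
Qed.

(** The boundary equation expresses the last strain by accelerations and a velocity; each interior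
    equation expresses the difference of adjacent strains by accelerations, so the property spreads
    from [N] down to 0. *)
Lemma negligible_strain (j : nat) : (j <= N)%N ->
  obs_negligible (fun w t => w 0 j.+1 t - w 0 j t).
Proof.
have time_gt0 z : 0 < jw_time z.
  by have /andP[+ _] := jw_itv z; apply: lt_le_trans; exact: jw_start_gt0.
have lin x y f h : obs_negligible f -> obs_negligible h ->
    obs_negligible (fun w t => x * f w t + y * h w t).
  exact: (negligible_sqr_lin start_energy_ge0).
have ext f h : (forall w t, fem_jet g d N w -> 0 < t -> f w t = h w t) ->
    obs_negligible h -> obs_negligible f.
  by move=> fh; apply: negligible_le => z; rewrite fh //; exact: jw_jetP.
have g0 : g != 0 by rewrite gt_eqF.
suff H i : (i <= N)%N -> obs_negligible (fun w t => w 0 (N - i).+1 t - w 0 (N - i)%N t).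
  by move=> jN; have := H (N - j)%N (leq_subr _ _); rewrite subKn.
elim: i => [|i IHi] iN.
  rewrite subn0.
  apply: ext (lin (- g^-1 / 6) (- d / g) _ _
    (lin 2 1 _ _ (negligible_velocity 1 (leqnn _)) (negligible_velocity 1 (leqnSn _)))
    (negligible_velocity 0 (leqnn _))) => w t jw t0.
  have /eqP := jet_right jw 0 t0; rewrite -subr_eq0 => /eqP e.
  rewrite -[RHS]addr0 -[X in _ = _ + X](mulr0 g^-1) -[X in _ = _ + _ * X]e.
  by field; rewrite g0.
have Ni : (N - i = (N - i.+1).+1)%N by rewrite -subSn.
have iN' : (1 <= N - i <= N)%N by lia.
apply: ext (lin (- (g^-1 / 6)) 1 _ _ (lin 1 1 _ _ (lin 1 4 _ _
    (negligible_velocity (j := (N - i).+1) 1 ltac:(lia))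
    (negligible_velocity (j := N - i) 1 ltac:(lia)))
    (negligible_velocity (j := N - i.+1) 1 ltac:(lia))) (IHi (ltnW iN)))
  => w t jw t0.
have := jet_interior jw 0 iN' t0; rewrite Ni /= => e.
rewrite -[RHS]addr0 -[X in _ = _ + X](mulr0 g^-1) -[X in _ = _ + _ * X]e.
by field; rewrite g0.
Qed.

Lemma jet_energy_contraction : exists2 rho : R, 0 < rho < 1 &
  forall w a, fem_jet g d N w -> 0 < a ->
    jet_energy g N w (a + s) <= rho * jet_energy g N w a.
Proof.
have E0 := start_energy_ge0.
have g6 : 0 <= 6 * g by rewrite mulr_ge0 // ltW.
have : negligible start_energy energy_drop
    (fun z => jet_energy g N (jw_jet z) (jw_time z)).
  apply: negligibleD; first exact: negligible_velocity.
  apply: (negligible_sum E0) => j jN.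
  have nj := negligible_velocity 0 (ltnW jN).
  have nj1 := negligible_velocity 0 (jN : (j.+1 <= N.+1)%N).
  apply: negligibleD; last exact: (negligibleZ E0 g6 (negligible_strain jN)).
  apply: negligibleD; first exact: (negligibleZ E0 _ nj).
  have := negligible_sqr_lin E0 1 1 nj nj1.
  by apply: negligible_le => z; rewrite !mul1r.
have h0 : 0 < 2^-1 :> R by rewrite invr_gt0.
move=> /(_ _ h0) [C C0 HC].
have C1 : 0 < (2 * (C + 1))^-1 by rewrite invr_gt0; lra.
have C2 : (2 * (C + 1))^-1 < 1 by rewrite invf_lt1; lra.
(* With [eta = 1/2] at the start of the window, [E <= E / 2 + C * (E - E')]. Since [E' <= E], [C]
   may be replaced by [C + 1], which keeps the factor in []0, 1[] even if [C = 0]. *)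
exists (1 - (2 * (C + 1))^-1); first by lra.
move=> w a jw a0.
have I : a <= a <= a + s by rewrite lexx lerDl ltW.
have := HC (JetWindow jw a0 I); rewrite /energy_drop /start_energy /=.
have := jet_energy_nincr d_gt0 jw a0 (ltac:(lra) : a <= a + s).
set E := jet_energy g N w a; set E' := jet_energy g N w (a + s) => le1 le2.
rewrite mulrBl mul1r lerBrDr -lerBrDl mulrC ler_pdivrMr; last by lra.
by lra.
Qed.

End Observability.

(** * From the finite element system to its jets *)

Local Open Scope classical_set_scope.

Lemma is_derive_tderive (R : realType) (f : R -> R) (t : R) :
  0 < t -> tderivable f t -> is_derive t 1 f (tderive f t).
Proof.
move=> t0 ft.
have ft' : tquot f t s @[s --> within [set s | 0 <= s] t^'] --> tderive f t := ft.
suff H : h^-1 *: (f (h *: 1 + t) - f t) @[h --> 0^'] --> tderive f t.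
  by split; [apply/cvg_ex; exists (tderive f t)|apply/cvg_lim].
apply/cvgrPdist_lt => e e0.
move/cvgrPdist_lt : ft' => /(_ e e0); rewrite !near_withinE => /nbhs_ballP[r /= r0 B].
(* A radius of at most [t] keeps [x + t] in the half-line to which [tderive] is confined. *)
apply/nbhs_ballP; exists (Num.min r t); first by rewrite /= lt_min r0.
move=> x; rewrite /ball /= sub0r normrN lt_min => /andP[xr xt] x0.
rewrite /GRing.scale /= mulr1.
have := B (x + t); rewrite /ball /= opprD addrCA subrr addr0 normrN => /(_ xr).
rewrite -[X in _ != X]add0r (inj_eq (addIr _)) => /(_ x0).
have -> : 0 <= x + t by move: xt; rewrite ltr_norml => /andP[]; lra.
by move=> /(_ isT); rewrite /tquot addrK mulrC.
Qed.

(** Needed to carry the decay estimate from positive starting times to 0: [f s] is the difference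
    quotient times [s], plus [f 0]. *)
Lemma tderivable_right_cvg0 (R : realType) (f : R -> R) :
  tderivable f 0 -> f s @[s --> 0^'+] --> f 0.
Proof.
move=> f0.
have f0' : tquot f 0 s @[s --> 0^'+] --> tderive f 0.
  have : tquot f 0 s @[s --> within [set s | 0 <= s] (0 : R)^'] --> tderive f 0 := f0.
  move=> H; apply: cvg_trans H; apply: cvg_app => A.
  suff : nbhs (0 : R) (fun s => s != 0 -> 0 <= s -> A s) ->
         nbhs (0 : R) (fun s => 0 < s -> A s) by [].
  apply: filterS => s As s0.
  by apply: As; rewrite /= ?gt_eqF // ltW.
have : (tquot f 0 s * s + f 0) @[s --> 0^'+] --> tderive f 0 * 0 + f 0.
  apply: cvgD; last exact: cvg_cst.
  apply: cvgM => //.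
  by apply: cvg_within_filter; exact: cvg_id.
rewrite mulr0 add0r; apply: cvg_trans; apply: near_eq_cvg.
near=> s; rewrite /tquot subr0 divfK ?subrK //.
Unshelve. all: by end_near.
Qed.

Lemma tderive_eq0 (R : realType) (f : R -> R) (t : R) :
  (forall s, 0 <= s -> f s = 0) -> 0 < t -> tderivable f t -> tderive f t = 0.
Proof.
move=> f0 t0 /(is_derive_tderive t0) H.
have : is_derive t 1 f 0.
  apply: near_eq_is_derive (is_derive_cst (0 : R) t 1).
  by near=> s; rewrite f0 // ltW //; near: s; exact: lt_nbhsr.
by move=> H0; rewrite -(derive_val (is_derive := H)) (derive_val (is_derive := H0)).
Unshelve. all: by end_near.
Qed.

(** Stiffness and damping terms, numbered as in [mass_row]: the scheme equates [mass_row] of the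
    accelerations with this. *)
Definition fem_force (R : realType) (g d : R) (N : nat) (x y : nat -> R) (l : nat) : R :=
  if l == N then - d * y N.+1 - g * (x N.+1 - x N)
  else g * (x l.+2 - 2 * x l.+1 + x l).

(* If x and y are the derivatives of orders k and k + 1 and K inverts the mass
   matrix, this is the derivative of order k + 2. *)
Definition fem_next (R : realType) (g d : R) (N : nat) (K : 'M[R]_N.+1)
    (x y : nat -> R -> R) (j : nat) (t : R) : R :=
  if j is i.+1 then
    if (i <= N)%N then
      \sum_(l < N.+1) K (inord i) l * fem_force g d N (x^~ t) (y^~ t) l
    else 0
  else 0.

Lemma is_derive_fem_force (R : realType) (g d : R) (N : nat)
    (x y x' y' : nat -> R -> R) (l : nat) (t : R) :
  (forall j, is_derive t 1 (x j) (x' j t)) ->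
  (forall j, is_derive t 1 (y j) (y' j t)) ->
  is_derive t 1 (fun s => fem_force g d N (x^~ s) (y^~ s) l)
    (fem_force g d N (x'^~ t) (y'^~ t) l).
Proof.
move=> Dx Dy; rewrite /fem_force; case: eqP => _.
  have D := is_deriveB (is_deriveZ (- d) (Dy N.+1))
    (is_deriveZ g (is_deriveB (Dx N.+1) (Dx N))).
  rewrite (_ : (fun s => _) = - d *: y N.+1 - g *: (x N.+1 - x N)); first exact: D.
  by apply/funext => s; rewrite !fctE.
have D := is_deriveZ g
  (is_deriveD (is_deriveB (Dx l.+2) (is_deriveZ 2 (Dx l.+1))) (Dx l)).
rewrite (_ : (fun s => _) = g *: (x l.+2 - 2 *: x l.+1 + x l)); first exact: D.
by apply/funext => s; rewrite !fctE.
Qed.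

Lemma is_derive_fem_next (R : realType) (g d : R) (N : nat) (K : 'M[R]_N.+1)
    (x y x' y' : nat -> R -> R) (j : nat) (t : R) :
  (forall j, is_derive t 1 (x j) (x' j t)) ->
  (forall j, is_derive t 1 (y j) (y' j t)) ->
  is_derive t 1 (fem_next g d K x y j) (fem_next g d K x' y' j t).
Proof.
move=> Dx Dy; rewrite /fem_next; case: j => [|i]; first exact: is_derive_cst.
case: leqP => iN; last exact: is_derive_cst.
have D l := is_deriveZ (K (inord i) l) (is_derive_fem_force g d N l Dx Dy).
have := is_derive_sum (fun l : 'I_N.+1 => D l).
rewrite (_ : \sum_(_ < _) _ = fun s => \sum_(l < N.+1) K (inord i) l *
   fem_force g d N (x^~ s) (y^~ s) l); first by [].
by apply/funext => s; rewrite fct_sumE.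
Qed.

(** Each derivative depends on the two preceding ones, so the recursion carries consecutive
    pairs. *)
Fixpoint fem_jet_pair (R : realType) (g d : R) (N : nat) (K : 'M[R]_N.+1)
    (x y : nat -> R -> R) (k : nat) : (nat -> R -> R) * (nat -> R -> R) :=
  if k is k'.+1 then
    let p := fem_jet_pair g d K x y k' in (p.2, fem_next g d K p.1 p.2)
  else (x, y).

(** A solution is only assumed twice differentiable. Solved for the accelerations, the scheme makes
    them linear in displacements and velocities, hence differentiable again; iteration yields all
    orders. *)
Lemma fem_solution_jet (R : realType) (c xi h : R) (N : nat)
    (v0 v1 : 'rV[R]_N.+2) (v : 'I_N.+2 -> R -> R) :
  fem_solution c xi h v0 v1 v ->
  exists2 w, fem_jet (c ^+ 2 / h ^+ 2) (xi / h) N w &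
    forall j t, (j <= N.+1)%N -> 0 < t ->
      w 0 j t = v (inord j) t /\ w 1 j t = tderive (v (inord j)) t.
Proof.
move=> sol; set g := c ^+ 2 / h ^+ 2; set d := xi / h.
have [K KE] := mass_inverse R N.
(* Zero at node 0 and beyond [N.+1]: the clamped condition of a jet then holds at all times, and
   [inord] is only applied in range. *)
pose on (f : 'I_N.+2 -> R -> R) (j : nat) : R -> R :=
  if (0 < j <= N.+1)%N then f (inord j) else cst 0.
pose x := on v; pose y := on (fun j => tderive (v j)).
pose w k := (fem_jet_pair g d K x y k).1.
have w1 : w 1 = y by [].
have wSS k : w k.+2 = fem_next g d K (w k) (w k.+1) by [].
have v00 t : 0 < t -> tderive (v (inord 0)) t = 0.
  move=> t0; apply: tderive_eq0 => // [s s0|].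
    exact: (fem_left sol).
  by apply: (fem_derivable sol); exact: ltW.
have v000 t : 0 < t -> tderive (tderive (v (inord 0))) t = 0.
  move=> t0.
  have := is_derive_tderive t0 (@fem_derivable2 _ _ _ _ _ _ _ _ sol (inord 0) _ (ltW t0)).
  move=> H.
  have H0 : is_derive t 1 (tderive (v (inord 0))) 0.
    apply: near_eq_is_derive (is_derive_cst (0 : R) t 1).
    by near=> s; rewrite v00 //; near: s; exact: lt_nbhsr.
  by rewrite -(derive_val (is_derive := H)) (derive_val (is_derive := H0)).
have xE j t : (j <= N.+1)%N -> 0 < t -> x j t = v (inord j) t.
  move=> jN t0; rewrite /x /on jN andbT; case: posnP => // ->.
  by rewrite (fem_left sol) // ltW.
have yE j t : (j <= N.+1)%N -> 0 < t -> y j t = tderive (v (inord j)) t.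
  move=> jN t0; rewrite /y /on jN andbT; case: posnP => // ->.
  by rewrite v00.
(* Inverting the mass matrix identifies the constructed second derivative with the actual one. *)
have aE j t : (j <= N.+1)%N -> 0 < t -> w 2 j t = tderive (tderive (v (inord j))) t.
  case: j => [|i] iN t0; first by rewrite v000.
  pose a j := if j == 0 then 0 else tderive (tderive (v (inord j))) t.
  have aE j : (j <= N.+1)%N -> a j = tderive (tderive (v (inord j))) t.
    by rewrite /a; case: j => // _; rewrite v000.
  have := (KE a (fem_force g d N (x^~ t) (y^~ t)) erefl).1.
  move=> /(_ _ (inord i)); rewrite inordK // => H.
  rewrite wSS /fem_next (iN : (i <= N)%N) -H ?aE // => l.
  rewrite /mass_row /fem_force; case: eqP => lN.
    have := fem_right sol (ltW t0).
    by rewrite !aE ?xE ?yE // -/d => e; rewrite /g; lra.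
  have lN' : (l < N)%N by rewrite ltn_neqAle -ltnS ltn_ord andbT; apply/eqP.
  have /= := fem_interior sol (lN' : (1 <= l.+1 <= N)%N) (ltW t0).
  rewrite !aE ?xE //; try lia.
  by rewrite /g; lra.
exists w; last by move=> j t jN t0; rewrite -xE // -yE.
split.
- suff : forall k, (forall j (t : R), 0 < t -> is_derive t 1 (w k j) (w k.+1 j t)) /\
      (forall j (t : R), 0 < t -> is_derive t 1 (w k.+1 j) (w k.+2 j t)).
    by move=> H k; case: (H k).
  elim=> [|k [IH1 IH2]]; last first.
    split=> // j t t0; rewrite wSS [w k.+3]wSS.
    by apply: is_derive_fem_next => i; [exact: IH1|exact: IH2].
  split=> j t t0.
    rewrite w1 /w /= /x /y /on; case: ifP => _; last exact: is_derive_cst.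
    by apply: is_derive_tderive => //; apply: (fem_derivable sol); exact: ltW.
  rewrite w1 {1}/y /on; case: ifP => jN; last first.
    suff -> : w 2 j t = 0 by exact: is_derive_cst.
    by rewrite wSS /fem_next; case: j jN => //= i; rewrite ltnS => ->.
  rewrite aE //; last by case/andP: jN.
  by apply: is_derive_tderive => //; apply: (fem_derivable2 sol); exact: ltW.
- by case=> [|[|k]] t.
- move=> k j t jN t0; case: j jN => // j jN.
  have := (KE (fun j => w k.+2 j t) (fem_force g d N ((w k)^~ t) ((w k.+1)^~ t)) erefl).2.
  move=> /(_ _ (Ordinal (ltnW jN : (j < N.+1)%N))).
  rewrite /mass_row /fem_force /= ltn_eqF // => -> /=; first by rewrite subrr.
  by move=> i; rewrite wSS /fem_next -ltnS ltn_ord inord_val.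
- move=> k t t0.
  have := (KE (fun j => w k.+2 j t) (fem_force g d N ((w k)^~ t) ((w k.+1)^~ t)) erefl).2.
  move=> /(_ _ ord_max); rewrite /mass_row /fem_force /= eqxx => -> /=; first by lra.
  by move=> i; rewrite wSS /fem_next -ltnS ltn_ord inord_val.
Unshelve. all: by end_near.
Qed.

(** * Exponential decay *)

(** Induction on the number of windows of length [s] before [t]: each full window costs
    [rho <= expR (- (delta * s))], and the factor [expR (delta * s)] absorbs the last, incomplete
    one, where only monotonicity is used. *)
Lemma contraction_exp_decay (R : realType) (E : R -> R) (s delta rho : R) :
  0 < s -> 0 < delta ->
  (forall a b, 0 < a -> a <= b -> E b <= E a) ->
  (forall a, 0 < a -> 0 <= E a) ->
  (forall a, 0 < a -> E (a + s) <= rho * E a) ->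
  rho <= expR (- (delta * s)) ->
  forall a t, 0 < a -> a <= t -> E t <= expR (delta * (s - (t - a))) * E a.
Proof.
move=> s0 d0 Emono E0 Es rho_le.
have H n : forall a t, 0 < a -> a <= t -> t - a <= n.+1%:R * s ->
    E t <= expR (delta * (s - (t - a))) * E a.
  elim: n => [|n IHn] a t a0 at_ tn.
    apply: le_trans (Emono _ _ a0 at_) _; rewrite ler_peMl ?E0 // -expR0 ler_expR.
    by rewrite mulr_ge0 ?(ltW d0) //; lra.
  have [ts|ts] := leP (t - a) s.
    apply: le_trans (Emono _ _ a0 at_) _; rewrite ler_peMl ?E0 // -expR0 ler_expR.
    by rewrite mulr_ge0 ?(ltW d0) //; lra.
  have as0 : 0 < a + s by rewrite addr_gt0.
  have tn' : t - (a + s) <= n.+1%:R * s.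
    by move: tn; rewrite -[n.+2]addn1 natrD mulrDl mul1r; lra.
  apply: le_trans (IHn _ _ as0 _ tn') _; first lra.
  rewrite [X in expR X](_ : _ = delta * (s - (t - a)) + delta * s); last by ring.
  rewrite expRD -mulrA ler_pM2l ?expR_gt0 //.
  apply: le_trans (ler_wpM2l (expR_ge0 _) (Es _ a0)) _.
  rewrite mulrA ler_piMl ?E0 // mulrC -ler_pdivlMr ?expR_gt0 //.
  by rewrite mul1r -expRN.
move=> a t a0 at_.
have [n ns] : exists n : nat, (t - a) / s <= n%:R.
  by exists (Num.trunc ((t - a) / s)).+1; rewrite ltW // truncnS_gt.
apply: (H n) => //; rewrite -ler_pdivrMr //; apply: le_trans ns _.
by rewrite ler_nat.
Qed.

Lemma fem_kappa_ge0 (R : realType) (c xi h : R) (N : nat) :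
  0 <= fem_kappa c xi h N.
Proof.
by have [[l _ ->] _] := fem_kappa_max c xi h N; rewrite mulr_ge0 ?sqr_ge0.
Qed.

Lemma fem_energy_right_cvg (R : realType) (c xi h : R) (N : nat)
    (v0 v1 : 'rV[R]_N.+2) (v : 'I_N.+2 -> R -> R) :
  fem_solution c xi h v0 v1 v ->
  fem_energy c h v t @[t --> 0^'+] --> fem_energy c h v 0.
Proof.
move=> sol.
have cv j : v j t @[t --> 0^'+] --> v j 0.
  by apply: tderivable_right_cvg0; exact: (fem_derivable sol).
have cv' j : tderive (v j) t @[t --> 0^'+] --> tderive (v j) 0.
  by apply: tderivable_right_cvg0; exact: (fem_derivable2 sol).
have cvX (f : R -> R) (l : R) : f t @[t --> 0^'+] --> l ->
    (`|f t| ^+ 2) @[t --> 0^'+] --> `|l| ^+ 2.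
  move=> fl; under eq_fun do rewrite expr2; rewrite expr2.
  by apply: cvgM; exact: cvg_norm.
have sumcvg (F : nat -> R -> R) (l : nat -> R) n :
    (forall j, F j t @[t --> 0^'+] --> l j) ->
    (\sum_(0 <= j < n) F j t) @[t --> 0^'+] --> \sum_(0 <= j < n) l j.
  move=> Fl; elim: n => [|n IHn].
    by rewrite big_geq //; under eq_fun do rewrite big_geq //; exact: cvg_cst.
  rewrite big_nat_recr //=; under eq_fun do rewrite big_nat_recr //=.
  exact: cvgD.
rewrite /fem_energy; apply: cvgM; first exact: cvg_cst.
apply: cvgD; first exact: cvX.
apply: sumcvg => j; apply: cvgD.
  apply: cvgD; last by apply: cvX; apply: cvgD.
  by apply: cvgM; [exact: cvg_cst|exact: cvX].
apply: cvgM; first exact: cvg_cst.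
by apply: cvX; apply: cvgM; [apply: cvgB|exact: cvg_cst].
Qed.

Lemma fem_energy_jet (R : realType) (c h : R) (N : nat)
    (v : 'I_N.+2 -> R -> R) (w : nat -> nat -> R -> R) (t : R) :
  (forall j, (j <= N.+1)%N ->
     w 0 j t = v (inord j) t /\ w 1 j t = tderive (v (inord j)) t) ->
  fem_energy c h v t = h / 12 * jet_energy (c ^+ 2 / h ^+ 2) N w t.
Proof.
move=> wE; rewrite /fem_energy /jet_energy; congr (_ * (_ + _)).
  by rewrite (wE N.+1 (leqnn _)).2 real_normK ?num_real.
apply: eq_big_nat => j /andP[_ jN].
have [-> ->] := wE j (ltnW jN); have [-> ->] := wE j.+1 jN.
by rewrite !real_normK ?num_real // expr_div_n; ring.
Qed.

Theorem theorem8 (R : realType) (c L xi : R) (N : nat) (h : R)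
    (c_gt0 : 0 < c) (L_gt0 : 0 < L) (xi_gt0 : 0 < xi)
    (hE : h = L / N.+1%:R) :
  exists delta : R,
    [/\ 0 < delta,
        delta < 2 * xi * c ^+ 2 / (L * (c ^+ 2 + xi ^+ 2))
      & forall v0 v1 : 'rV[R]_N.+2, v0 0 0 = 0 -> v1 0 0 = 0 ->
        forall v : 'I_N.+2 -> R -> R, fem_solution c xi h v0 v1 v ->
        forall t : R, 0 < t ->
          fem_energy c h v t <=
          (c + delta * L) / (c - delta * L)
          * expR (- delta * (1 - L * delta / c)
                  * (1 - fem_kappa c xi h N / (12 * c ^+ 2)) * t)
          * fem_energy c h v 0].
Proof.
have h_gt0 : 0 < h by rewrite hE divr_gt0.
set bound := _ / _.
have den_gt0 : 0 < L * (c ^+ 2 + xi ^+ 2) by rewrite mulr_gt0 // addr_gt0 // exprn_gt0.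
have bound_gt0 : 0 < bound by rewrite divr_gt0 // !mulr_gt0 // exprn_gt0.
have g_gt0 : 0 < c ^+ 2 / h ^+ 2 by rewrite divr_gt0 // exprn_gt0.
have d_gt0 : 0 < xi / h by rewrite divr_gt0.
have s_gt0 : 0 < L / c by rewrite divr_gt0.
have [rho /andP[rho_gt0 rho_lt1] contr] :=
  jet_energy_contraction N g_gt0 d_gt0 s_gt0.
(* The first bound gives the required upper limit; the second gives [delta * (L / c) <= 1 - rho],
   whence [rho <= expR (- (delta * (L / c)))] and [delta * (L / c) < 1]. *)
pose delta := Num.min (bound / 2) ((1 - rho) / (L / c)).
have delta_gt0 : 0 < delta.
  by rewrite lt_min; apply/andP; split; apply: divr_gt0 => //; lra.
have delta_lt : delta < bound.
  by apply: (@le_lt_trans _ _ (bound / 2)); [rewrite ge_min lexx|lra].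
have delta_s : delta * (L / c) <= 1 - rho.
  by rewrite -ler_pdivlMr // ge_min lexx orbT.
have rho_le : rho <= expR (- (delta * (L / c))).
  by apply: le_trans (expR_ge1Dx _); lra.
have x_gt0 : 0 < delta * (L / c) by rewrite mulr_gt0.
have x_lt1 : delta * (L / c) < 1 by lra.
exists delta; split=> // v0 v1 _ _ v sol t t_gt0.
have [w jw wE] := fem_solution_jet sol.
have EE u : 0 < u -> fem_energy c h v u = h / 12 * jet_energy (c ^+ 2 / h ^+ 2) N w u.
  by move=> u0; apply: fem_energy_jet => j jN; exact: wE.
have h12 : 0 < h / 12 by rewrite divr_gt0.
have E_ge0 a : 0 < a -> 0 <= fem_energy c h v a.
  by move=> a0; rewrite EE // mulr_ge0 ?jet_energy_ge0 // ltW.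
have decay : forall a t, 0 < a -> a <= t -> fem_energy c h v t <=
    expR (delta * (L / c - (t - a))) * fem_energy c h v a.
  apply: (contraction_exp_decay s_gt0 delta_gt0 _ E_ge0 _ rho_le).
    move=> a b a0 ab; have b0 := lt_le_trans a0 ab.
    by rewrite !EE // ler_pM2l // (jet_energy_nincr d_gt0 jw).
  move=> a a0; rewrite !EE ?addr_gt0 // mulrCA ler_pM2l //.
  exact: contr.
have cE := fem_energy_right_cvg sol.
have E0_ge0 : 0 <= fem_energy c h v 0.
  rewrite -(cvg_lim _ cE) //; apply: limr_ge; first exact: cvgP cE.
  by near=> a; apply: E_ge0; near: a; exact: nbhs_right_gt.
have decay0 : fem_energy c h v t <=
    expR (delta * (L / c - t)) * fem_energy c h v 0.
  (* The estimate holds from any [a > 0]; let [a] tend to 0 from the right. *)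
  have cf : expR (delta * (L / c - (t - a))) * fem_energy c h v a @[a --> 0^'+]
      --> expR (delta * (L / c - (t - 0))) * fem_energy c h v 0.
    apply: cvgM => //; apply: continuous_cvg; first exact: continuous_expR.
    apply: cvgM; first exact: cvg_cst.
    apply: cvgB; first exact: cvg_cst.
    apply: cvgB; first exact: cvg_cst.
    by apply: cvg_within_filter; exact: cvg_id.
  rewrite -[X in _ - X]subr0 -(cvg_lim _ cf) //; apply: limr_ge; first exact: cvgP cf.
  near=> a; apply: decay; first by near: a; exact: nbhs_right_gt.
  by near: a; exact: nbhs_right_le.
apply: le_trans decay0 _; apply: ler_wpM2r => //.
(* [expR (delta * (L / c))] is compared with the prefactor and [expR (- (delta * t))] with the
   exponential. With [x = delta * (L / c)] in []0, 1[] and [k >= 0] the kappa term,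
   [(1 - x) * (1 - k) <= 1], so the claimed rate is at most [delta]. *)
rewrite mulrBr expRD.
apply: ler_pM; rewrite ?expR_ge0 //; last first.
  rewrite ler_expR !mulNr lerN2 ler_pM2r //.
  rewrite -mulrA ler_piMr ?(ltW delta_gt0) //.
  have k0 : 0 <= fem_kappa c xi h N / (12 * c ^+ 2).
    by rewrite divr_ge0 ?fem_kappa_ge0 // mulr_ge0 ?sqr_ge0.
  have -> : 1 - L * delta / c = 1 - delta * (L / c) by ring.
  have : 0 <= (1 - delta * (L / c)) * (fem_kappa c xi h N / (12 * c ^+ 2)).
    by rewrite mulr_ge0 // subr_ge0 ltW.
  lra.
have -> : (c + delta * L) / (c - delta * L) =
    (1 + delta * (L / c)) / (1 - delta * (L / c)).
  field; rewrite (gt_eqF c_gt0) /=.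
  move: x_lt1; rewrite mulrA ltr_pdivrMr // mul1r => dL.
  by rewrite !gt_eqF // subr_gt0.
(* With [x = delta * (L / c)]: [exp(x) (1 - x) <= exp(x) exp(-x) = 1 <= 1 + x]. *)
have e1 : 1 - delta * (L / c) <= expR (- (delta * (L / c))) := expR_ge1Dx _.
rewrite ler_pdivlMr ?subr_gt0 //.
apply: le_trans (ler_wpM2l (expR_ge0 _) e1) _.
by rewrite -expRD subrr expR0; lra.
Unshelve. all: by end_near.
Qed.
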